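(* Let $n\ge 5$ be an integer and let $K=\{123,132,321\}$. The number of equivalence classes of $S_n$ under $K$-equivalence is $(n-1)!!+(n-2)!!+n-2$.
   Context: Permutations in $S_n$ are written as words $\pi_1\pi_2\cdots\pi_n$ in one-line notation. The order permutation of a word $u$ of $c$ distinct positive integers is the unique $\sigma\in S_c$ with $\sigma_i<\sigma_j$ iff $u_i<u_j$. A replacement partition $K$ of $S_c$ is a set partition of $S_c$; it is denoted by listing its parts with the one-element parts (and outer brackets) omitted, so here $K$ is the set partition of $S_3$ whose only part of size greater than one is $\{123,132,321\}$. The $K$-equivalence on $S_n$ is the equivalence relation generated by: $\phi\equiv\psi$ whenever $\phi=aub$ and $\psi=avb$ (concatenations) for some possibly empty words $a,b$ and words $u,v$ of length $c$ (so $u,v$ occupy the same $c$ consecutive positions) such that the order permutations of $u$ and $v$ lie in the same part of $K$. All equivalence classes are counted, including one-element classes. $m!!$ is the double factorial: the product of all positive integers at most $m$ having the same parity as $m$. *)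

(* Defs.v *)
From Stdlib Require Import Relation_Operators.
From mathcomp Require Import all_boot all_fingroup.

Set Implicit Arguments.
Unset Strict Implicit.
Unset Printing Implicit Defensive.

(* 'S_n acts on {0, ..., n-1}; words use the letters 1, ..., n. *)
Definition one_line n (s : 'S_n) : seq nat :=
  [seq (val (s i)).+1 | i <- enum 'I_n].

Definition is_order_perm c (u : seq nat) (sigma : 'S_c) : bool :=
  (size u == c) &&
  [forall i : 'I_c, forall j : 'I_c,
     (sigma i < sigma j) == (nth 0 u i < nth 0 u j)].

Definition same_part c (K : {set {set 'S_c}}) (u v : seq nat) : bool :=
  [exists P in K, exists sigma in P, exists tau in P,
     is_order_perm u sigma && is_order_perm v tau].

(* k is the length of the common prefix; K_stepP gives the form phi = aub,
   psi = avb. *)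
Definition K_step c n (K : {set {set 'S_c}}) : rel 'S_n := fun phi psi =>
  let x := one_line phi in let y := one_line psi in
  [exists k : 'I_n.+1,
     [&& take k x == take k y,
         drop (k + c) x == drop (k + c) y
       & same_part K (take c (drop k x)) (take c (drop k y))]].

(* K_step is symmetric, so its reflexive transitive closure is the equivalence
   relation it generates; see K_equivP. *)
Definition K_equiv c n (K : {set {set 'S_c}}) : rel 'S_n :=
  connect (K_step K).

Definition K_classes c n (K : {set {set 'S_c}}) : {set {set 'S_n}} :=
  equivalence_partition (K_equiv K) [set: 'S_n].
Arguments K_classes {c} n K.

(* The set partition whose parts of size greater than one are listed in Ps. *)
Definition with_singletons (T : finType) (Ps : {set {set T}}) : {set {set T}} :=
  Ps :|: [set [set x] | x in ~: cover Ps].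

Definition K_123_132_321 : {set {set 'S_3}} :=
  with_singletons
    [set [set s : 'S_3 |
            one_line s \in [:: [:: 1; 2; 3]; [:: 1; 3; 2]; [:: 3; 2; 1]]]].

Definition double_factorial (m : nat) : nat :=
  \prod_(1 <= i < m.+1 | odd i == odd m) i.

Lemma size_one_line n (s : 'S_n) : size (one_line s) = n.
Proof. by rewrite size_map size_enum_ord. Qed.

Lemma one_line_inj n : injective (@one_line n).
Proof.
move=> s t /eq_in_map e; apply/permP => i.
by apply/val_inj/succn_inj/e; rewrite mem_enum.
Qed.

Lemma same_part_size c (K : {set {set 'S_c}}) u v :
  same_part K u v -> size u = c /\ size v = c.
Proof.
by case/existsP=> P /andP[_ /existsP[s /andP[_ /existsP[t]]]];
  case/and3P=> _ /andP[/eqP-> _] /andP[/eqP-> _].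
Qed.

Lemma same_part_sym c (K : {set {set 'S_c}}) u v :
  same_part K u v = same_part K v u.
Proof.
by apply/idP/idP=> /existsP[P /andP[KP /existsP[s /andP[Ps /existsP[t]]]]];
  case/and3P=> Pt us vt; apply/existsP; exists P; rewrite KP;
  apply/existsP; exists t; rewrite Pt; apply/existsP; exists s;
  rewrite Ps us vt.
Qed.

Lemma K_step_sym c n (K : {set {set 'S_c}}) : symmetric (@K_step c n K).
Proof.
move=> phi psi; apply: eq_existsb => k.
by rewrite same_part_sym [take k _ == _]eq_sym [drop _ _ == _]eq_sym.
Qed.

Lemma K_stepP c n (K : {set {set 'S_c}}) (phi psi : 'S_n) :
  reflect (exists a u v b : seq nat,
             [/\ one_line phi = a ++ u ++ b, one_line psi = a ++ v ++ b,
                 size u = c, size v = c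
               & same_part K u v])
          (K_step K phi psi).
Proof.
apply: (iffP existsP) => [[k /and3P[/eqP ea /eqP eb uv]]|].
  have [su sv] := same_part_size uv.
  exists (take k (one_line phi)), (take c (drop k (one_line phi))),
         (take c (drop k (one_line psi))), (drop (k + c) (one_line phi)).
  split=> //; first by rewrite addnC -drop_drop !cat_take_drop.
  by rewrite ea eb addnC -drop_drop !cat_take_drop.
move=> [a [u [v [b [ephi epsi su sv uv]]]]].
have ka : size a < n.+1.
  by rewrite ltnS -(size_one_line phi) ephi size_cat leq_addr.
exists (Ordinal ka); rewrite /= ephi epsi !take_size_cat // eqxx /=.
rewrite addnC -!drop_drop !drop_size_cat // eqxx /=.
by rewrite !take_size_cat.
Qed.

Lemma K_equivP c n (K : {set {set 'S_c}}) (phi psi : 'S_n) :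
  reflect (clos_refl_sym_trans 'S_n (fun x y => K_step K x y) phi psi)
          (K_equiv K phi psi).
Proof.
apply: (iffP idP) => [/connectP[p]|].
  elim: p phi => [|x p IHp] phi /=; first by move=> _ ->; apply: rst_refl.
  case/andP=> px pp epsi; apply: (rst_trans _ _ _ x).
    exact: rst_step.
  exact: IHp.
elim=> {phi psi} [x y|x|x y _|x y z _ xy _]; first exact: connect1.
- exact: connect0.
- by rewrite /K_equiv (sym_connect_sym (@K_step_sym c n K)).
exact: connect_trans.
Qed.

Lemma with_singletons_partition (T : finType) (Ps : {set {set T}}) :
  trivIset Ps -> set0 \notin Ps -> partition (with_singletons Ps) [set: T].
Proof.
move=> tP nP; have mem1 (A : {set T}) x :
    A \in with_singletons Ps -> x \in A ->
    (A \in Ps) || (A == [set x]) && (x \notin cover Ps).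
  case/setUP=> [->//|/imsetP[y]]; rewrite inE => ny -> /set1P->.
  by rewrite eqxx ny orbT.
apply/and3P; split.
- rewrite eqEsubset subsetT; apply/subsetP=> x _; apply/bigcupP.
  have [/bigcupP[A PA Ax]|nx] := boolP (x \in cover Ps).
    by exists A; rewrite // inE PA.
  by exists [set x]; rewrite ?set11 // inE imset_f ?orbT // inE.
- apply/trivIsetP=> A B PA PB; apply: contraR => /pred0Pn[x /andP[/= Ax Bx]].
  case/orP: (mem1 _ _ PA Ax) => [kA|/andP[/eqP-> nx]];
    case/orP: (mem1 _ _ PB Bx) => [kB|/andP[/eqP-> nx']] //.
  + apply: contraT => nAB; move/trivIsetP: tP => /(_ _ _ kA kB nAB).
    by move/pred0P/(_ x); rewrite /= Ax Bx.
  + by case/negP: nx'; apply/bigcupP; exists A.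
  + by case/negP: nx; apply/bigcupP; exists B.
- rewrite !inE negb_or nP; apply/imsetP=> -[x _ /setP/(_ x)].
  by rewrite !inE eqxx.
Qed.

Lemma K_123_132_321_partition : partition K_123_132_321 [set: 'S_3].
Proof.
apply: with_singletons_partition.
  by apply/trivIsetP=> A B /set1P-> /set1P->; rewrite eqxx.
rewrite inE eq_sym; apply/set0Pn; exists 1%g; rewrite inE.
rewrite /one_line enum_ordSl enum_ordSl enum_ordSl /= !perm1.
by rewrite (size0nil (size_enum_ord 0)).
Qed.

(* Main.v *)
Require Import Defs.
From Stdlib Require Import Relation_Operators.
From mathcomp Require Import all_boot all_fingroup zify.

Set Implicit Arguments.
Unset Strict Implicit.
Unset Printing Implicit Defensive.

(** Call a word an avoider if no three consecutive letters form a 123, a 132 or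
    a 321. An avoider is alone in its class. The theorem follows from two facts:
    there are (n-1)!! + (n-2)!! avoiders, and the other words form n-2 classes.

    Avoiders. The least letter m of an avoider is last or next to last, for with
    the next two letters it would form a 123 or a 132. If m is next to last, the
    last letter is free. If m is last, then, without m, the word is an avoider
    whose last letter is not the least one, and conversely. Hence the number of avoiders of
    length k that end with the least letter satisfies g(k) = (k-2) g(k-2), so
    g(k) = (k-2)!!, and the total is g(n) + (n-1) g(n-1); see [end_min_rec],
    [count_avoids] and [count_avoidsE].

    Reduction. A letter m less than all the next letters rearranges them at will:
    it exchanges the two letters behind it, and it hops over two letters by
    m x y -> y x m for x < y, does its work there and hops back
    ([eqv_min_perm]). Every word that is not an avoider can be brought to a form
    with two letters behind its least letter ([nonavoid_min_inside]). An
    induction on the length, which removes either the greatest or the least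
    letter and starts with a finite check for five letters, then reaches one of
    n-2 canonical words ([reducible_ge5]). The canonical word of index j has the
    letters 1, 2, 3, ... at places j, j-2, j-4, ... (from 0), as far as these
    exist, and the other letters in increasing order.

    Separation. That the letters 1, ..., i+1 stand at places of one parity, in
    decreasing order, is invariant under replacement ([descending_eqv]). The
    parity of the place of 1 and the greatest such i determine the index of a
    canonical word ([canon_inj]). *)

(** * The replacement relation on words *)

(** The words on letters [x < y < z] that may replace one another: those with
    order permutation 123, 132 or 321. *)
Definition triples (x y z : nat) : seq (seq nat) :=
  [:: [:: x; y; z]; [:: x; z; y]; [:: z; y; x]].

(** One replacement inside a word of natural numbers, in either direction. *)
Inductive step : seq nat -> seq nat -> Prop :=
  Step a b x y z u v of x < y & y < z & u \in triples x y z
                      & v \in triples x y z : step (a ++ u ++ b) (a ++ v ++ b).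

(** The equivalence generated by the replacements. *)
Definition eqv : seq nat -> seq nat -> Prop := clos_refl_sym_trans _ step.

Lemma eqv_refl w : eqv w w. Proof. exact: rst_refl. Qed.

Lemma eqv_sym u v : eqv u v -> eqv v u. Proof. exact: rst_sym. Qed.

Lemma eqv_trans v u w : eqv u v -> eqv v w -> eqv u w.
Proof. exact: rst_trans. Qed.

Lemma eqv_cat a b u v : eqv u v -> eqv (a ++ u ++ b) (a ++ v ++ b).
Proof.
elim=> {u v} [_ _ [c d x y z u v xy yz ut vt]|u|u v _|u v w _ uv _].
- rewrite -!catA [in eqv _ _]catA [X in eqv _ X]catA.
  by apply: rst_step; apply: (Step _ _ xy yz).
- exact: eqv_refl.
- exact: eqv_sym.
- exact: eqv_trans.
Qed.

Lemma eqv_catl a u v : eqv u v -> eqv (a ++ u) (a ++ v).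
Proof. by move/(@eqv_cat a [::]); rewrite !cats0. Qed.

Lemma eqv_catr b u v : eqv u v -> eqv (u ++ b) (v ++ b).
Proof. exact: (@eqv_cat [::] b). Qed.

Lemma eqv_cons x u v : eqv u v -> eqv (x :: u) (x :: v).
Proof. exact: (@eqv_catl [:: x]). Qed.

Lemma triples_perm x y z u : u \in triples x y z -> perm_eq u [:: x; y; z].
Proof.
rewrite !inE => /or3P[] /eqP->; rewrite ?perm_refl //.
  by rewrite perm_cons (perm_catC [:: z] [:: y]).
by have/permPl := perm_rev [:: x; y; z].
Qed.

Lemma step_perm u v : step u v -> perm_eq u v.
Proof.
case=> {u v} a b x y z u v _ _ /triples_perm pu /triples_perm pv.
by rewrite perm_cat2l perm_cat2r (permPl pu) perm_sym.
Qed.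

Lemma eqv_perm u v : eqv u v -> perm_eq u v.
Proof.
elim=> {u v} [u v|//|u v _|u v w _ uv _]; first exact: step_perm.
- by rewrite perm_sym.
- exact: perm_trans.
Qed.

Lemma eqv_triples x y z u v :
  x < y -> y < z -> u \in triples x y z -> v \in triples x y z -> eqv u v.
Proof.
move=> xy yz ut vt; apply: rst_step; rewrite -[u]cats0 -[v]cats0.
exact: (@Step [::] [::] _ _ _ _ _ xy yz).
Qed.

Lemma eqv_swap m x y : m < x -> m < y -> eqv [:: m; x; y] [:: m; y; x].
Proof.
move=> mx my; case: (ltngtP x y) => [xy|yx|->]; last exact: eqv_refl.
  by apply: (eqv_triples mx xy); rewrite !inE eqxx ?orbT.
by apply: (eqv_triples my yx); rewrite !inE eqxx ?orbT.
Qed.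

Lemma eqv_hop m x y : m < x -> x < y -> eqv [:: y; x; m] [:: m; x; y].
Proof. by move=> mx xy; apply: (eqv_triples mx xy); rewrite !inE eqxx ?orbT. Qed.

(** The cases follow the rank of [a] among [a], [x], [y]; when [a] is not the
    least of the three, the triple [a x y] or [a y x] itself is replaced. *)
Lemma eqv_swap_third m a x y :
  m < a -> m < x -> m < y -> a != x -> a != y ->
  eqv [:: m; a; x; y] [:: m; a; y; x].
Proof.
wlog xy : x y / x < y.
  move=> W ma mx my ax ay; case: (ltngtP x y) => [xy|yx|->].
  - exact: W.
  - by apply: eqv_sym; apply: W.
  - exact: eqv_refl.
move=> ma mx my ax ay.
case: (ltngtP a x) ax => // [lax|lxa] _.
  by apply: (eqv_cons m); apply: eqv_swap; lia.
apply: (eqv_trans (eqv_catr [:: y] (eqv_swap ma mx))) => /=.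
case: (ltngtP a y) ay => // [lay|lya] _; last first.
  apply: (eqv_trans (eqv_cons m (eqv_swap lxa xy))).
  by apply: eqv_cons; apply: eqv_sym; apply: eqv_hop.
apply: eqv_sym; apply: (eqv_trans (eqv_catr [:: x] (eqv_swap ma my))) => /=.
by apply: eqv_cons; apply: eqv_hop.
Qed.

(** A minimal letter in front hops over the prefix two letters at a time, acts
    next to [x] and [y], and hops back. *)
Lemma eqv_min_adj m p x y q :
  all (ltn m) (p ++ [:: x; y]) -> uniq (p ++ [:: x; y]) ->
  eqv (m :: p ++ x :: y :: q) (m :: p ++ y :: x :: q).
Proof.
have [k] := ubnP (size p); elim: k p => // k IH [|c [|d p]] /=.
- by move=> _ /and3P[mx my _] _; apply: (eqv_catr q (eqv_swap mx my)).
- move=> _ /and4P[mc mx my _]; rewrite !inE negb_or -andbA.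
  case/and3P=> cx cy _; exact: (eqv_catr q (eqv_swap_third mc mx my cx cy)).
move=> sp /and3P[mc md mp] /and3P[]; rewrite inE negb_or => /andP[cd _] _ up.
have {}IH : eqv (m :: p ++ x :: y :: q) (m :: p ++ y :: x :: q).
  by apply: IH => //; lia.
wlog {cd} cd : c d mc md / c < d.
  move=> W; case: (ltngtP c d) cd => // [cd|dc] _; first exact: W.
  apply: (eqv_trans (eqv_catr _ (eqv_swap mc md))).
  apply: (eqv_trans _ (eqv_catr _ (eqv_swap md mc))); exact: W.
(* [m c d] becomes [d c m], so that the minimal letter stands before [p]. *)
apply: (eqv_trans (eqv_sym (eqv_catr _ (eqv_hop mc cd)))).
apply: (eqv_trans _ (eqv_catr _ (eqv_hop mc cd))).
exact: (eqv_catl [:: d; c]).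
Qed.

(** The letters behind a minimal letter can be rearranged at will. *)
Lemma eqv_min_perm m u v :
  all (ltn m) u -> uniq u -> perm_eq u v -> eqv (m :: u) (m :: v).
Proof.
rewrite -[u]cat0s -[v]cat0s perm_cat2l.
elim: u [::] v => [|x u IH] p v mu uu puv.
  by rewrite perm_sym in puv; rewrite (perm_nilP puv); apply: eqv_refl.
have xv : x \in v by rewrite -(perm_mem puv) mem_head.
case/splitPr: xv puv => q r puv.
have {}puv : perm_eq u (q ++ r).
  by rewrite -(perm_cons x) (permPl puv) -(cat1s x r) perm_catCA.
have e t : p ++ x :: t = rcons p x ++ t by rewrite cat_rcons.
apply: (@eqv_trans (m :: p ++ x :: q ++ r)).
  by rewrite !e; apply: IH; rewrite -?e.
move: mu uu.
have -> : all (ltn m) (p ++ x :: u) = all (ltn m) (p ++ x :: q ++ r).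
  by rewrite !all_cat /= (perm_all _ puv) all_cat.
have -> : uniq (p ++ x :: u) = uniq (p ++ x :: q ++ r).
  by apply: perm_uniq; rewrite perm_cat2l perm_cons.
elim: q p {IH puv e} => [|y q IH] p mp up; first exact: eqv_refl.
apply: (@eqv_trans (m :: p ++ y :: x :: q ++ r)).
  apply: eqv_min_adj.
    by move: mp; rewrite !all_cat /= => /and4P[-> -> -> _].
  by apply: subseq_uniq up; rewrite cat_subseq //= !eqxx sub0seq.
rewrite /= -!(cat_rcons y p); apply: IH.
  by move: mp; rewrite cat_rcons !all_cat /= => /and4P[-> -> -> ->].
rewrite -(perm_uniq (s1 := p ++ x :: y :: q ++ r)) // cat_rcons perm_cat2l.
by rewrite (perm_catCA [:: x] [:: y]).
Qed.

(** * Avoiders and the least letter *)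

(** The letters [x y z] have order permutation 123, 132 or 321. *)
Definition bad x y z := [|| x < y < z, x < z < y | z < y < x].

(** No three consecutive letters of [w] form a bad triple; these words are
    alone in their class. *)
Fixpoint avoids (w : seq nat) : bool :=
  if w is x :: w' then
    (if w' is y :: z :: _ then ~~ bad x y z else true) && avoids w'
  else true.

Lemma avoids_bad a x y z b : avoids (a ++ x :: y :: z :: b) -> ~~ bad x y z.
Proof. by elim: a => [/andP[]//|t a IH] /andP[_ /IH]. Qed.

Lemma avoids_catl a b : avoids (a ++ b) -> avoids a.
Proof.
elim: a => // x a IH /= /andP[h /IH->]; rewrite andbT.
by case: a h {IH} => [//|y [//|z a]].
Qed.

Lemma avoids_rcons u x y z :
  avoids (u ++ [:: x; y; z]) = avoids (u ++ [:: x; y]) && ~~ bad x y z.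
Proof.
elim: u => [|t u IH]; first by rewrite /= !andbT.
by rewrite /= {}IH andbA; congr (_ && _ && _); case: u => [|p [|q u]].
Qed.

Lemma avoids_rconsE u x y z :
  avoids (rcons (rcons (rcons u x) y) z)
  = avoids (rcons (rcons u x) y) && ~~ bad x y z.
Proof. by rewrite -!cats1 -!catA avoids_rcons. Qed.


(** Three consecutive letters of which the first is the least form a 123 or a
    132. *)
Lemma nonavoid_min a m b :
  all (ltn m) b -> uniq b -> 1 < size b -> ~~ avoids (a ++ m :: b).
Proof.
case: b => [//|y [//|z b]] /and3P[/= my mz _] /andP[]; rewrite inE negb_or.
case/andP=> yz _ _ _; apply: contraTN isT => /avoids_bad; rewrite /bad my mz /=.
by case: (ltngtP y z) yz.
Qed.

Lemma split_min (w : seq nat) :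
  w != [::] -> uniq w -> exists a m b, w = a ++ m :: b /\ all (ltn m) (a ++ b).
Proof.
elim: w => // x w IH _ /andP[xw uw].
have [->|/IH/(_ uw)[a [m [b [ew mw]]]]] := eqVneq w [::].
  by exists [::], x, [::].
case: (ltngtP x m) => [xm|mx|e].
- exists [::], x, w; split=> //; rewrite ew /= all_cat /=.
  rewrite xm; move: mw; rewrite all_cat => /andP[ma mb].
  by rewrite !(sub_all _ ma) ?(sub_all _ mb) // => t; apply: ltn_trans.
- by exists (x :: a), m, b; split; rewrite ?ew //= mx.
- by move: xw; rewrite ew e mem_cat mem_head orbT.
Qed.

(** Behind a minimal letter the last two letters can be put in decreasing
    order. *)
Lemma descent_after_min m b :
  all (ltn m) b -> uniq b -> 1 < size b ->
  exists c x y, [/\ m < x, x < y & eqv (m :: b) (m :: c ++ [:: y; x])].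
Proof.
case/lastP: b => // b y; case/lastP: b => // c x mb ub _.
move: (mb) (ub); rewrite !all_rcons !rcons_uniq mem_rcons inE negb_or.
case/and3P=> /= my mx _ /andP[/andP[nyx _] _].
have [xy|xy] := ltnP x y.
  exists c, x, y; split=> //; apply: eqv_min_perm => //.
  by rewrite -!cats1 -catA perm_cat2l (perm_catC [:: x]).
exists c, y, x; split=> //; first by rewrite ltn_neqAle nyx.
by rewrite -!cats1 -catA; apply: eqv_refl.
Qed.

Lemma eqv_uniq u v : eqv u v -> uniq u = uniq v.
Proof. by move/eqv_perm/perm_uniq. Qed.

(** A word that is not an avoider can be rewritten so that its least letter is
    followed by at least two letters. Otherwise the least letter ends the word
    or comes just before the end; the part before it is made to end in a
    descent, which the least letter hops over. *)
Lemma nonavoid_min_inside w :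
  uniq w -> ~~ avoids w ->
  exists a m b, [/\ eqv w (a ++ m :: b), all (ltn m) (a ++ b) & 1 < size b].
Proof.
have [k] := ubnP (size w); elim: k w => // k IH w sw uw nw.
have w0 : w != [::] by apply: contraNneq nw => ->.
have [a [m [b [ew mab]]]] := split_min w0 uw.
have [sb|sb] := ltnP 1 (size b).
  by exists a, m, b; split=> //; rewrite ew; apply: eqv_refl.
move: (mab); rewrite all_cat => /andP[ma mb].
have hopped c x y : all (ltn m) (c ++ y :: x :: b) -> x < y ->
    eqv w (c ++ [:: y; x] ++ m :: b) ->
  exists a m b, [/\ eqv w (a ++ m :: b), all (ltn m) (a ++ b) & 1 < size b].
  move=> mc xy ewc; exists c, m, [:: x, y & b]; split=> //.
    apply: (eqv_trans ewc); apply: (@eqv_cat c b [:: y; x; m] [:: m; x; y]).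
    by apply: eqv_hop => //; move: mc; rewrite all_cat /= => /and4P[].
  by move: mc; rewrite !all_cat /= => /and4P[-> -> -> ->].
have [na|aa] := boolP (~~ avoids a).
  have ua : uniq a by move: uw; rewrite ew cat_uniq => /andP[].
  have [|a' [m' [b' [ea mab' sb']]]] := IH a _ ua na.
    by move: sw; rewrite ew size_cat /=; lia.
  have : uniq (a' ++ m' :: b') by rewrite -(eqv_uniq ea).
  rewrite cat_uniq cons_uniq => /and3P[_ _ /andP[_ ub']].
  move: mab'; rewrite all_cat => /andP[_ mb'].
  have [c [x [y [_ xy ec]]]] := descent_after_min mb' ub' sb'.
  have ea2 : eqv a ((a' ++ m' :: c) ++ [:: y; x]).
    by apply: (eqv_trans ea); rewrite -catA; apply: eqv_catl.
  apply: (hopped (a' ++ m' :: c) x y) => //.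
    by rewrite -(cat1s y) -(cat1s x) !catA -(catA _ [:: y]) all_cat
      -(perm_all _ (eqv_perm ea2)) ma mb.
  by rewrite ew catA; apply: eqv_catr.
(* Now the prefix before the minimum is an avoider, so the bad triple is a 321
   ending in the minimum. *)
case/lastP: a ew mab ma aa => [|a x] ew mab ma.
  by move: nw; rewrite ew; case: b sb {ew mab mb hopped} => [|y []] //.
case/lastP: a ew mab ma => [|a y] ew mab ma.
  move: nw; rewrite ew; case: b sb mb {ew mab hopped} => [|z []] //= _.
  case/andP=> mz _ h; exfalso.
  by case/andP: ma h => /= mx _; rewrite /bad; lia.
rewrite negbK => aa.
have [xy|yx] := ltnP x y.
  apply: (hopped a x y) => //; last by rewrite ew !cat_rcons; apply: eqv_refl.
  by rewrite -!cat_rcons.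
move: ma; rewrite !all_rcons => /and3P[/= mx my _].
case: b {hopped mab} sb mb ew => [|z [|//]] _ mb ew; move: nw; rewrite ew.
  by rewrite cats1 avoids_rconsE aa => h; exfalso; move: h; rewrite /bad; lia.
rewrite -cat_rcons cats1 !avoids_rconsE aa => h; exfalso.
by case/andP: mb h => /= mz _; rewrite /bad; lia.
Qed.

Lemma nonavoid_end_descent w :
  uniq w -> ~~ avoids w -> exists c x y, x < y /\ eqv w (c ++ [:: y; x]).
Proof.
move=> uw nw; have [a [m [b [ew mab sb]]]] := nonavoid_min_inside uw nw.
move: uw mab; rewrite (eqv_uniq ew) cat_uniq cons_uniq all_cat.
case/and3P=> _ _ /andP[_ ub] /andP[_ mb].
have [c [x [y [_ xy ec]]]] := descent_after_min mb ub sb.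
exists (a ++ m :: c), x, y; split=> //.
by rewrite -catA; apply: (eqv_trans ew); apply: eqv_catl.
Qed.

(** * Canonical words *)

(** For a sorted word [s], the canonical word of index [j] has its least letter
    after [j] letters: index 0 gives [s] itself, index 1 exchanges the first two
    letters, and index [j + 2] inserts the least letter at place [j + 2] of the
    canonical word of index [j] on the other letters. For instance the words on
    1, ..., 7 are 1234567, 2134567, 2314567, 3241567, 3425167. Only indices
    with [j + 2 < size s] are used. *)
Fixpoint canon (s : seq nat) (j : nat) {struct j} : seq nat :=
  match j, s with
  | 1, x :: y :: t => y :: x :: t
  | j'.+2, m :: t => take j (canon t j') ++ m :: drop j (canon t j')
  | _, _ => s
  end.

Lemma canonSS m t j :
  canon (m :: t) j.+2 = take j.+2 (canon t j) ++ m :: drop j.+2 (canon t j).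
Proof. by []. Qed.

Lemma canon_ind (Q : seq nat -> nat -> Prop) :
  (forall s, Q s 0) -> Q [::] 1 -> (forall x, Q [:: x] 1) ->
  (forall x y t, Q [:: x, y & t] 1) -> (forall j, Q [::] j.+2) ->
  (forall m t j, Q t j -> Q (m :: t) j.+2) -> forall s j, Q s j.
Proof.
move=> h0 h1 h2 h3 h4 h5 s j; have [k] := ubnP j.
elim: k s j => // k IH s [|[|j]] // jk.
  by case: s => [|x [|y t]].
by case: s => // m t; apply: h5; apply: IH; lia.
Qed.

Lemma canon_perm s j : perm_eq (canon s j) s.
Proof.
move: s j.
apply: (canon_ind (Q := fun s j => is_true (perm_eq (canon s j) s))) => [s||x|x y t|j|m t j IH] //.
  by rewrite (perm_catCA [:: y] [:: x]).
rewrite canonSS -cat1s perm_catCA cat_take_drop.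
by rewrite perm_cons.
Qed.

Lemma size_canon s j : size (canon s j) = size s.
Proof. exact: perm_size (canon_perm s j). Qed.

Lemma canon_rcons s M j :
  j < size s -> canon (rcons s M) j = rcons (canon s j) M.
Proof.
move: s j; apply: (canon_ind (Q := fun s j => j < size s ->
  canon (rcons s M) j = rcons (canon s j) M)) => // m t j IH; rewrite [size _]/= => sj.
rewrite rcons_cons !canonSS IH; last by lia.
rewrite drop_rcons ?size_canon // -rcons_cons -rcons_cat.
by rewrite -[rcons (canon t j) M]cats1 takel_cat ?size_canon //; lia.
Qed.

Lemma map_canon (f : nat -> nat) s j : map f (canon s j) = canon (map f s) j.
Proof.
move: s j.
apply: (canon_ind (Q := fun s j => map f (canon s j) = canon (map f s) j)) => // m t j IH.
by rewrite canonSS map_cat /= map_take map_drop IH.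
Qed.

Lemma canon_split m t j :
  j < size (m :: t) ->
  exists c e, canon (m :: t) j = c ++ m :: e /\ size c = j.
Proof.
case: j => [|[|j]] jt.
- by exists [::], t.
- by case: t jt => // y t _; exists [:: y], t.
- exists (take j.+2 (canon t j)), (drop j.+2 (canon t j)); split=> //.
  by rewrite size_takel // size_canon.
Qed.

(** The triples that may replace [x y z]; none if [x y z] is not bad. *)
Definition reorder (x y z : nat) : seq (seq nat) :=
  if x < y < z then triples x y z
  else if x < z < y then triples x z y
  else if z < y < x then triples z y x else [::].

(** The words that one replacement makes of [w]. *)
Fixpoint successors (w : seq nat) : seq (seq nat) :=
  if w is x :: w' then
    [seq x :: v | v <- successors w'] ++
    (if w' is y :: z :: b then [seq u ++ b | u <- reorder x y z] else [::])
  else [::].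

Lemma reorderP x y z u : u \in reorder x y z -> eqv [:: x; y; z] u.
Proof.
rewrite /reorder; case: ifP => [/andP[h1 h2] ut|_].
  by apply: (eqv_triples h1 h2 _ ut); rewrite !inE eqxx ?orbT.
case: ifP => [/andP[h1 h2] ut|_].
  by apply: (eqv_triples h1 h2 _ ut); rewrite !inE eqxx ?orbT.
case: ifP => // /andP[h1 h2] ut.
by apply: (eqv_triples h1 h2 _ ut); rewrite !inE eqxx ?orbT.
Qed.

Lemma successorsP w v : v \in successors w -> eqv w v.
Proof.
elim: w v => // x w IH v /=; rewrite mem_cat => /orP[/mapP[u /IH wu ->]|].
  exact: eqv_cons.
case: w {IH} => [//|y [//|z b]] /mapP[u /reorderP h ->].
exact: (eqv_catr b h).
Qed.

(** Breadth-first search of depth [k]: [seen] lists the words found so far and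
    [front] those found at the last stage. *)
Fixpoint reach k (seen front : seq (seq nat)) : seq (seq nat) :=
  if k is k'.+1 then
    let new := undup [seq v <- flatten (map successors front) | v \notin seen] in
    reach k' (new ++ seen) new
  else seen.

Lemma reachP k w seen front v :
  (forall u, u \in seen -> eqv w u) -> (forall u, u \in front -> eqv w u) ->
  v \in reach k seen front -> eqv w v.
Proof.
elim: k seen front => [|k IH] seen front hs hf /=; first exact: hs.
set new := undup _; have hn u : u \in new -> eqv w u.
  rewrite mem_undup mem_filter => /andP[_ /flatten_mapP[t /hf wt]].
  by move/successorsP; apply: eqv_trans.
apply: IH => // u; rewrite mem_cat => /orP[/hn|/hs] //.
Qed.

(** All words on five letters: the search from the three canonical words finds
    every word that is not an avoider. *)
Lemma five_letters_check :
  let big := flatten [seq let w := canon (iota 0 5) j in reach 10 [:: w] [:: w]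
                     | j <- iota 0 3] in
  all (fun w => avoids w || (w \in big)) (permutations (iota 0 5)).
Proof. by vm_compute. Qed.

Lemma five_letters w :
  perm_eq w (iota 0 5) -> ~~ avoids w ->
  exists2 j, j < 3 & eqv w (canon (iota 0 5) j).
Proof.
rewrite -mem_permutations => /(allP five_letters_check) /orP[->//|].
case/flatten_mapP=> j; rewrite mem_iota => /andP[_ j3] h _.
exists j => //; apply/eqv_sym/(reachP _ _ h) => u; rewrite inE => /eqP->;
  exact: eqv_refl.
Qed.

Lemma eqv_map (f : nat -> nat) u v :
  {in u &, {homo f : x y / x < y}} -> eqv u v -> eqv (map f u) (map f v).
Proof.
move=> fu uv; elim: uv fu => {u v} [u v uv|u|u v uv IH|u v w uv IH1 _ IH2] fu.
- case: uv fu => {u v} a b x y z u v xy yz ut vt fu; rewrite !map_cat.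
  have mu t : t \in [:: x; y; z] -> t \in a ++ u ++ b.
    by rewrite -(perm_mem (triples_perm ut)) !mem_cat => ->; rewrite orbT.
  apply: eqv_cat; apply: (@eqv_triples (f x) (f y) (f z)).
  + by apply: fu => //; apply: mu; rewrite !inE eqxx ?orbT.
  + by apply: fu => //; apply: mu; rewrite !inE eqxx ?orbT.
  + by move: ut; rewrite !inE => /or3P[] /eqP->; rewrite /= eqxx ?orbT.
  + by move: vt; rewrite !inE => /or3P[] /eqP->; rewrite /= eqxx ?orbT.
- exact: eqv_refl.
- apply: eqv_sym; apply: IH => x y xu yu.
  by apply: fu; rewrite -(perm_mem (eqv_perm uv)).
- apply: (eqv_trans (IH1 fu)); apply: IH2 => x y xu yu.
  by apply: fu; rewrite (perm_mem (eqv_perm uv)).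
Qed.

Lemma avoids_map (f : nat -> nat) w :
  {in w &, {mono f : x y / x < y}} -> avoids (map f w) = avoids w.
Proof.
elim: w => // x w IH fw; rewrite /= IH; last first.
  by move=> y z yw zw; apply: fw; rewrite inE ?yw ?zw orbT.
case: w {IH} fw => [//|y [//|z w]] fw; rewrite /= /bad.
by rewrite !fw // !inE eqxx ?orbT.
Qed.

Lemma five_letters_canon s w :
  sorted ltn s -> size s = 5 -> perm_eq w s -> ~~ avoids w ->
  exists2 j, j + 2 < size s & eqv w (canon s j).
Proof.
move=> ss s5 ws nw.
have us : uniq s by apply: sorted_uniq ss; [exact: ltn_trans|exact: ltnn].
pose f := nth 0 s; have f5 : map f (iota 0 5) = s.
  by rewrite -s5 map_nth_iota0 // take_size.
have fh x y : x < 5 -> y < 5 -> x < y -> f x < f y.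
  by move=> x5 y5; apply: (sorted_ltn_nth ltn_trans) => //; rewrite inE s5.
have fm x y : x < 5 -> y < 5 -> (f x < f y) = (x < y).
  move=> x5 y5; case: (ltngtP x y) => [xy|yx|->]; last exact: ltnn.
    exact: fh.
  by have := fh _ _ y5 x5 yx; lia.
(* [w0] is [w] with every letter replaced by its rank in [s]. *)
pose w0 := map (index^~ s) w.
have ew : w = map f w0.
  rewrite -map_comp -[LHS]map_id; apply/eq_in_map => x xw /=.
  by rewrite /f nth_index // -(perm_mem ws).
have pw0 : perm_eq w0 (iota 0 5).
  rewrite (perm_trans (perm_map _ ws)) // -[X in map _ X]f5 -map_comp.
  rewrite (_ : map _ _ = iota 0 5) // -[RHS]map_id; apply/eq_in_map => i.
  by rewrite mem_iota /= => i5; rewrite /f index_uniq // s5.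
have fw0 : {in w0 &, {mono f : x y / x < y}}.
  by move=> x y; rewrite !(perm_mem pw0) !mem_iota => x5 y5; apply: fm.
have [|j j3 ej] := five_letters pw0; first by rewrite -(avoids_map fw0) -ew.
exists j; first by rewrite s5; lia.
rewrite ew -[X in canon X]f5 -map_canon; apply: eqv_map => // x y xw yw.
by rewrite fw0.
Qed.

(** * Reduction to canonical words *)

Lemma sorted_uniq_nat s : sorted ltn s -> uniq s.
Proof. by apply: sorted_uniq; [exact: ltn_trans|exact: ltnn]. Qed.

Lemma sorted_min m t : sorted ltn (m :: t) -> all (ltn m) t.
Proof. exact/order_path_min/ltn_trans. Qed.

Lemma min_unique m t m' a b :
  sorted ltn (m :: t) -> perm_eq (a ++ m' :: b) (m :: t) ->
  all (ltn m') (a ++ b) -> m' = m.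
Proof.
move=> /sorted_min/allP mt p /allP mab; apply/eqP; rewrite eqn_leq.
have : m \in a ++ m' :: b by rewrite (perm_mem p) mem_head.
have : m' \in m :: t by rewrite -(perm_mem p) mem_cat mem_head orbT.
rewrite !inE mem_cat inE orbCA -mem_cat.
move=> /orP[/eqP->|/mt/= m1]; first by rewrite leqnn.
by move=> /orP[/eqP->|/mab/= m2]; rewrite ?leqnn //; lia.
Qed.

(** The word [w] is equivalent to a canonical word on the sorted letters [s]. *)
Definition has_canonical (s w : seq nat) :=
  exists2 j, j + 2 < size s & eqv w (canon s j).

Lemma has_canonical_eqv s v w : eqv w v -> has_canonical s v -> has_canonical s w.
Proof. by move=> wv [j sj ej]; exists j => //; apply: eqv_trans ej. Qed.

(** Every word with [n] distinct letters that is not an avoider is equivalent to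
    a canonical word. *)
Definition reducible n := forall s w, sorted ltn s -> size s = n ->
  perm_eq w s -> ~~ avoids w -> has_canonical s w.

(** The greatest letter ends every canonical word. *)
Lemma canon_rcons_split s M j :
  sorted ltn (rcons s M) -> j + 2 < size (rcons s M) ->
  exists m t c e, [/\ rcons s M = m :: t, 0 < size e, size c = j,
    canon (rcons s M) j = c ++ m :: rcons e M & all (ltn m) (c ++ rcons e M)].
Proof.
move=> ss sj; case: s ss sj => [|m s]; first by rewrite /= addn2.
rewrite rcons_cons => ss sj.
have [c [e [ec sc]]] : exists c e, canon (m :: s) j = c ++ m :: e /\ size c = j.
  by apply: canon_split; move: sj; rewrite /= size_rcons; lia.
have := canon_rcons M (s := m :: s) (j := j); rewrite rcons_cons => ecM.
exists m, (rcons s M), c, e; split=> //.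
- have := size_canon (m :: s) j; rewrite ec size_cat /=.
  by move: sj; rewrite /= size_rcons; lia.
- by rewrite ecM ?ec ?rcons_cat //; move: sj; rewrite /= size_rcons; lia.
have := sorted_min ss; rewrite all_rcons -rcons_cat all_rcons => /andP[-> /= ms].
have := canon_perm (m :: s) j; rewrite ec -cat1s perm_catCA perm_cons => pc.
by rewrite (perm_all _ pc).
Qed.

(** When at least three letters follow the least one, the hypothesis for [n]
    letters applies in front of the last letter [z]. Unless [z] is the greatest
    letter [M] already, this brings [M] behind the least one; after an exchange
    of [M] and [z] the hypothesis applies again, now in front of [M]. *)
Lemma long_tail n s a m b :
  reducible n -> sorted ltn s -> size s = n.+1 -> perm_eq (a ++ m :: b) s ->
  all (ltn m) (a ++ b) -> 2 < size b -> has_canonical s (a ++ m :: b).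
Proof.
move=> IH ss sn ps mab; case/lastP: b ps mab => // b z ps mab.
rewrite size_rcons ltnS => sb; have us := sorted_uniq_nat ss.
have : uniq (a ++ m :: rcons b z) by rewrite (perm_uniq ps).
rewrite -rcons_cons -rcons_cat rcons_uniq => /andP[znotin].
rewrite cat_uniq cons_uniq => /and3P[_ _ /andP[_ ub]].
have := mab; rewrite -rcons_cat all_rcons all_cat => /and3P[/= mz ma mb].
have nu : ~~ avoids (a ++ m :: b) by apply: nonavoid_min.
case/lastP: s ss sn ps us => // s M ss; rewrite size_rcons => -[sn] ps us.
have ss0 : sorted ltn s.
  by apply: subseq_sorted (subseq_rcons _ _) ss; exact: ltn_trans.
(* A word that is not an avoider, followed by the greatest letter. *)
have fin u : perm_eq u s -> ~~ avoids u -> has_canonical (rcons s M) (rcons u M).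
  move=> pu /(IH s u ss0 sn pu)[j sj ej].
  exists j; first by rewrite size_rcons ltnW.
  rewrite canon_rcons; last by rewrite (leq_trans _ sj) // addn2 ltnS leqW.
  by rewrite -!cats1; apply: eqv_catr.
have psc P : count P a + P m + count P b + P z = count P s + P M.
  move/seq.permP/(_ P): ps; rewrite count_cat /= -!cats1 !count_cat /=; clear; lia.
have [eM|neM] := eqVneq z M.
  rewrite eM; apply: fin => //; apply/seq.permP => P.
  by move: (psc P); rewrite eM count_cat /=; clear; lia.
have zs : z \in s.
  have : z \in rcons s M by rewrite -(perm_mem ps) mem_cat inE mem_rcons mem_head !orbT.
  by rewrite mem_rcons inE (negPf neM).
case/splitPr: zs ss sn psc us fin ps ss0 => p q ss sn psc us fin ps ss0.
have ss1 : sorted ltn (rcons (p ++ q) M).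
  apply: subseq_sorted ss; first exact: ltn_trans.
  by rewrite -!cats1 -!catA cat_subseq // subseq_cons.
have pu1 : perm_eq (a ++ m :: b) (rcons (p ++ q) M).
  apply/seq.permP => P; move: (psc P).
  by rewrite -cats1 !count_cat /=; clear; lia.
have [|j sj ej] := IH _ _ ss1 _ pu1 nu.
  by move: sn; rewrite size_rcons !size_cat /=; clear; lia.
have [m' [t [c [e [es se sc ecan mce]]]]] := canon_rcons_split ss1 sj.
have em : m' = m.
  apply/esym/(@min_unique m' t m a b); rewrite -?es //.
  by rewrite all_cat ma.
move: ecan mce; rewrite {m' es}em => ecan.
rewrite all_cat all_rcons => /and3P[mc /= mM me].
have pce P : count P c + count P e + P M = count P a + count P b.
  have := seq.permP (canon_perm (rcons (p ++ q) M) j) P.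
  rewrite ecan -(seq.permP pu1) !count_cat /= -cats1 count_cat /=; clear; lia.
have ez : uniq (rcons (rcons e M) z).
  have : uniq (c ++ m :: rcons (rcons e M) z).
    rewrite -(perm_uniq (s1 := rcons (p ++ z :: q) M)) //; apply/seq.permP => P.
    rewrite -cats1 !count_cat /= -!cats1 !count_cat /=.
    by move: (psc P) (pce P); rewrite count_cat /=; clear; lia.
  by rewrite cat_uniq => /and3P[_ _ /andP[]].
have mez : all (ltn m) (rcons (rcons e M) z) by rewrite !all_rcons /= mz mM.
apply: (has_canonical_eqv (v := rcons (c ++ m :: rcons e z) M)).
  apply: (@eqv_trans (c ++ m :: rcons (rcons e M) z)).
    rewrite -[m :: rcons _ z]rcons_cons -rcons_cat -ecan -!(cats1 _ z).
    exact: eqv_catr.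
  rewrite rcons_cat rcons_cons; apply/eqv_catl/eqv_min_perm => //.
  by apply/seq.permP => P; rewrite -!cats1 !count_cat; clear; lia.
apply: fin.
  apply/seq.permP => P; move: (psc P) (pce P).
  by rewrite !count_cat /= -cats1 !count_cat /=; clear; lia.
apply: nonavoid_min; rewrite ?size_rcons //.
  by rewrite all_rcons /= mz.
by apply: subseq_uniq ez; rewrite -!cats1 -catA cat_subseq // suffix_subseq.
Qed.

(** If the least letter [m] is followed by two letters [c < d] only, it hops to
    the end and leaves a word [v] on the other letters. If [v] is an avoider, its
    last letters [x y d c] satisfy [x > y], and [m] hops over [x y] instead.
    Otherwise [v] is equivalent to a canonical word, and [m] hops back into that
    word: over four letters, over two letters, or over two letters and then
    over the least letter of [v] and the one before it. *)
Lemma reducible_step n : 4 < n -> reducible n -> reducible n.+1.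
Proof.
move=> n5 IH [//|m t] w ss [sn] pw nw.
have us := sorted_uniq_nat ss; have uw : uniq w by rewrite (perm_uniq pw).
have st : sorted ltn t by exact: path_sorted ss.
have mt := sorted_min ss.
have rest a b : eqv w (a ++ m :: b) -> perm_eq (a ++ b) t.
  move=> /eqv_perm ew; rewrite -(perm_cons m) -(permPr pw) (permPr ew).
  by rewrite -[m :: b]cat1s perm_sym perm_catCA.
have above a b x : eqv w (a ++ m :: b) -> x \in a ++ b -> m < x.
  by move=> /rest/perm_mem-> /(allP mt).
have long a b : eqv w (a ++ m :: b) -> 2 < size b -> has_canonical (m :: t) w.
  move=> ew sb; apply: (has_canonical_eqv ew).
  apply: (long_tail IH ss _ _ _ sb); first by rewrite /= sn.
    by apply: perm_trans pw; rewrite perm_sym eqv_perm.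
  by rewrite (perm_all _ (rest _ _ ew)).
have hop a x y b : x < y -> eqv w (a ++ [:: y, x, m & b]) ->
    eqv w (a ++ [:: m, x, y & b]).
  move=> xy ew; apply: (eqv_trans ew); apply: (@eqv_cat a b [:: y; x; m] [:: m; x; y]).
  apply: eqv_hop => //; apply: (above (a ++ [:: y; x]) b); rewrite -?catA //.
  by rewrite mem_cat !inE eqxx !orbT.
have [a [m' [b [ew mab sb]]]] := nonavoid_min_inside uw nw.
have em : m' = m.
  by apply: (min_unique ss _ mab); apply: perm_trans pw; rewrite perm_sym eqv_perm.
rewrite {m'}em in ew mab; have [sb3|] := ltnP 2 (size b); first exact: long ew sb3.
case: b ew mab sb => [|c [|d [|//]]] // ew mab _ _.
wlog cd : c d ew mab / c < d.
  move=> W; have [mc md] : m < c /\ m < d.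
    by move: mab; rewrite all_cat /= => /and4P[].
  case: (ltngtP c d) => [|dc|ecd]; first exact: W.
  - apply: (W d c) => //.
      apply: (eqv_trans ew); apply: eqv_catl; exact: eqv_swap.
    by move: mab; rewrite !all_cat /= => /and4P[-> -> -> _].
  - move: uw; rewrite (eqv_uniq ew) ecd cat_uniq => /and3P[_ _] /=.
    by rewrite !inE eqxx /= !andbF.
have pv : perm_eq (a ++ [:: d; c]) t.
  rewrite -(permPr (rest _ _ ew)) perm_cat2l.
  by rewrite (perm_catC [:: d] [:: c]).
have ewv : eqv w (rcons (a ++ [:: d; c]) m).
  apply: (eqv_trans ew); rewrite -cats1 -catA; apply: eqv_catl.
  apply/eqv_sym/eqv_hop => //; apply: (above a [:: c; d]) => //.
  by rewrite mem_cat !inE eqxx !orbT.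
have [av|nv] := boolP (avoids (a ++ [:: d; c])).
  have := perm_size pv; rewrite size_cat sn /=.
  case/lastP: a av ew {mab pv ewv} => [|a y]; first by move: n5; clear=> /=; lia.
  case/lastP: a => [|a x] av ew; rewrite ?size_rcons => sa.
    by move: n5 sa; clear=> /=; lia.
  (* No 321 and 132 give [c < y < d], and then no 123 gives [y < x]. *)
  have ydc : ~~ bad y d c.
    by move: av; rewrite cat_rcons; apply: avoids_bad.
  have xyd : ~~ bad x y d.
    by move: av; rewrite !cat_rcons; apply: avoids_bad.
  apply: (long a [:: y; x; c; d]) => //; apply: hop.
    have : uniq (rcons (rcons a x) y ++ [:: m; c; d]) by rewrite -(eqv_uniq ew).
    rewrite !cat_rcons cat_uniq /= !inE !negb_or -!andbA.
    move=> /and5P[_ _ _ _ H]; move: H ydc xyd cd; rewrite /bad; clear; lia.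
  by move: ew; rewrite !cat_rcons.
have [j sj ej] := IH _ _ st sn pv nv.
have [m2 [c' [e [ec sc me ue se]]]] : exists m2 c' e, [/\ canon t j = c' ++ m2 :: e,
    size c' = j, all (ltn m2) (c' ++ e), uniq e & j + size e + 1 = n].
  case: t st sn sj {ss pw us mt rest above long pv ej} => [|m2 t] st sn sj.
    by move: sj; rewrite addn2.
  have [c' [e [ec sc]]] := canon_split (leq_ltn_trans (leq_addr 2 j) sj).
  have pc := canon_perm (m2 :: t) j.
  exists m2, c', e; split=> //.
  - have := sorted_min st; rewrite -(perm_all _ (s1 := c' ++ e)) //.
    by rewrite -(perm_cons m2) -(permPr pc) ec -[m2 :: e]cat1s perm_sym perm_catCA.
  - have := sorted_uniq_nat st; rewrite -(perm_uniq pc) ec cat_uniq cons_uniq.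
    by case/and3P=> _ _ /andP[].
  - by rewrite -sn -(perm_size pc) ec size_cat sc /=; clear; lia.
have {ewv ej}ewv : eqv w (c' ++ m2 :: rcons e m).
  apply: (eqv_trans ewv); rewrite -rcons_cons -rcons_cat -ec -!(cats1 _ m).
  exact: eqv_catr.
have {}me : all (ltn m2) c' /\ all (ltn m2) e by apply/andP; rewrite -all_cat.
case: me => mc' me.
have mme : all (ltn m) e.
  have : perm_eq (c' ++ m2 :: e) t by rewrite -ec canon_perm.
  by move/perm_all=> pt; move: mt; rewrite -pt all_cat /= => /and3P[].
have e2 : 1 < size e by move: sj se; rewrite sn; clear; lia.
have [c1 [x [y [m2x xy ec1]]]] := descent_after_min me ue e2.
have ewc : eqv w (c' ++ m2 :: c1 ++ [:: m; x; y]).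
  have -> : c' ++ m2 :: c1 ++ [:: m; x; y] = (c' ++ m2 :: c1) ++ [:: m; x; y].
    by rewrite -catA.
  apply: hop => //; apply: (eqv_trans ewv); rewrite -catA; apply: eqv_catl.
  rewrite -rcons_cons -cats1.
  have -> : (m2 :: c1) ++ [:: y; x; m] = (m2 :: c1 ++ [:: y; x]) ++ [:: m].
    by rewrite /= -catA.
  exact: eqv_catr.
have pe : perm_eq e (c1 ++ [:: y; x]) by rewrite -(perm_cons m2) eqv_perm.
have se1 : size e = (size c1).+2 by rewrite (perm_size pe) size_cat /= addn2.
have uc1 : uniq c1 by move: ue; rewrite (perm_uniq pe) cat_uniq => /andP[].
have mc1 : all (ltn m2) c1.
  by move: me; rewrite (perm_all _ pe) all_cat => /andP[].
(* [size e] is 2, 3, or at least 4. *)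
case: c1 ec1 ewc pe se1 uc1 mc1 => [|k [|k' c1]] ec1 ewc pe se1 uc1 mc1.
- case/lastP: c' ec sc mc' ewv ewc => [|c' z] ec.
    by move: n5 se se1 => + + + /= sc; rewrite -sc; clear=> /=; lia.
  rewrite size_rcons all_rcons !cat_rcons => sc /andP[/= m2z _] _ ewc.
  apply: (long c' [:: m2; z; x; y]) => //.
  exact: (hop c' m2 z [:: x; y]).
- exists j.+2; first by rewrite /= sn; move: se se1; clear=> /=; lia.
  apply: (eqv_trans ewv).
  case: e e2 se1 ec me ue mme {ec1 pe se ewv} => [|e0 [|e1 [|e2 [|//]]]] //.
  move=> _ _ ec me ue mme.
  have cE : canon (m :: t) j.+2 = (c' ++ [:: m2; e0]) ++ [:: m; e1; e2].
    rewrite canonSS ec -[m2 :: _]/([:: m2; e0] ++ _) catA.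
    have sj2 : j.+2 = size (c' ++ [:: m2; e0]) by rewrite size_cat sc addn2.
    by rewrite sj2 take_size_cat // drop_size_cat.
  case/and4P: mme => _ me1 me2 _.
  have -> : c' ++ m2 :: rcons [:: e0; e1; e2] m = (c' ++ [:: m2; e0]) ++ [:: e1; e2; m].
    by rewrite -catA.
  rewrite cE; case: (ltngtP e1 e2) => [lt12|lt21|e12].
  + apply: (@eqv_trans ((c' ++ [:: m2; e0]) ++ [:: e2; e1; m])).
      rewrite -!catA; apply: eqv_catl.
      apply: (@eqv_catr [:: m] [:: m2; e0; e1; e2] [:: m2; e0; e2; e1]).
      apply: eqv_min_perm => //; rewrite perm_cons.
      by rewrite (perm_catC [:: e1] [:: e2]).
    by apply: eqv_catl; apply: eqv_hop.
  + apply: eqv_catl; apply: (eqv_trans (eqv_hop me2 lt21)).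
    exact: eqv_swap.
  + by move: ue; rewrite e12 /= !inE eqxx !andbF.
have nP : ~~ avoids (c' ++ [:: m2, k, k' & c1]) by apply: nonavoid_min.
have uP : uniq (c' ++ [:: m2, k, k' & c1]).
  move: uw; rewrite (eqv_uniq ewc).
  rewrite -[_ :: _ ++ _]/([:: m2, k, k' & c1] ++ _) catA cat_uniq.
  by case/andP.
have [d1 [x2 [y2 [xy2 eP]]]] := nonavoid_end_descent uP nP.
apply: (long d1 [:: x2; y2; x; y]) => //; apply: hop => //.
apply: (eqv_trans ewc).
have -> : c' ++ m2 :: [:: k, k' & c1] ++ [:: m; x; y] =
   (c' ++ [:: m2, k, k' & c1]) ++ [:: m; x; y] by rewrite -catA.
have -> : d1 ++ [:: y2; x2; m; x; y] = (d1 ++ [:: y2; x2]) ++ [:: m; x; y].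
  by rewrite -catA.
exact: eqv_catr.
Qed.

Lemma reducible_ge5 n : 4 < n -> reducible n.
Proof.
elim: n => // n IH; rewrite ltnS leq_eqVlt => /predU1P[<-|n5].
  by move=> s w ss s5 pw nw; have [j] := five_letters_canon ss s5 pw nw; exists j.
by apply: reducible_step => //; apply: IH.
Qed.

(** * An invariant that separates the canonical words *)

(** The letters 1, ..., [i + 1] all stand at places of parity [p] (counted from
    0), and their places decrease as the letter grows. *)
Definition descending p i (w : seq nat) :=
  (forall l, 0 < l <= i.+1 -> odd (index l w) = p) /\
  (forall l l', 0 < l < l' -> l' <= i.+1 -> index l' w < index l w).

Lemma index_cat3 l (a u b : seq nat) :
  size u = 3 -> index l (a ++ u ++ b) =
  if l \in a then index l a
  else size a + (if l \in u then index l u else 3 + index l b).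
Proof. by move=> su; rewrite !index_cat su. Qed.

(** Two of the letters 1, ..., [i + 1] in one window would stand at its ends with
    the greater one first and a letter above both in the middle, as in 231, which
    is not replaced. Hence a replacement moves at most one of them, the least
    letter of the window, by two places, and it does not pass another of them. *)
Lemma descending_step p i u v :
  step u v -> uniq u -> 0 \notin u -> descending p i u -> descending p i v.
Proof.
case=> {u v} a b x y z u v xy yz ut vt uu u0 [par dec].
have pu := triples_perm ut; have pv := triples_perm vt.
have su : size u = 3 by rewrite (perm_size pu).
have sv : size v = 3 by rewrite (perm_size pv).
have nota l : l \in [:: x; y; z] -> (l \in a) = false.
  rewrite -(perm_mem pu) => lu; apply/negbTE; move: uu.
  rewrite uniq_catCA cat_uniq => /and3P[_ + _]; apply: contra => la.
  by apply/hasP; exists l; rewrite // mem_cat la.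
have inu l : (l \in u) = (l \in [:: x; y; z]) by rewrite (perm_mem pu).
have inv l : (l \in v) = (l \in [:: x; y; z]) by rewrite (perm_mem pv).
have x0 : 0 < x.
  rewrite lt0n; apply: contra u0 => /eqP <-.
  by rewrite !mem_cat inu mem_head orbT.
have ix : index x (a ++ u ++ b) = size a + index x u.
  by rewrite index_cat3 // nota ?inu ?mem_head.
have jx : index x (a ++ v ++ b) = size a + index x v.
  by rewrite index_cat3 // nota ?inv ?mem_head.
have [nxy nyx nzx nzy] : [/\ (x == y) = false, (y == x) = false,
    (z == x) = false & (z == y) = false].
  by clear -xy yz; split; lia.
have uxE : (index x u == 0) || (index x u == 2).
  by move: ut; rewrite !inE => /or3P[] /eqP-> /=; rewrite ?eqxx ?nzx ?nyx.
have vxE : (index x v == 0) || (index x v == 2).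
  by move: vt; rewrite !inE => /or3P[] /eqP-> /=; rewrite ?eqxx ?nzx ?nyx.
(* The window holds at most one of the letters 1, ..., i.+1. *)
have yi : i.+1 < y.
  rewrite ltnNge; apply/negP => yi.
  have xyi : 0 < x < y by rewrite x0.
  have := dec x y xyi yi; have := par y; have := par x.
  have -> : index y (a ++ u ++ b) = size a + index y u.
    by rewrite index_cat3 // nota ?inu ?inE ?eqxx ?orbT.
  rewrite ix (ltnW (leq_trans xy yi)) yi x0 (ltn_trans x0 xy) => /(_ isT) px /(_ isT) py.
  move: ut px py; rewrite !inE => /or3P[] /eqP-> /=;
    rewrite ?eqxx ?nxy ?nyx ?nzx ?nzy ?eqxx.
  - by clear; lia.
  - by clear; lia.
  - by move=> <-; rewrite !oddD; case: (odd _).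
have same l : l <= i.+1 -> l != x -> index l (a ++ v ++ b) = index l (a ++ u ++ b).
  move=> li lx; rewrite !index_cat3 // inu inv !inE (negPf lx).
  by have [-> ->] : (l == y) = false /\ (l == z) = false by clear -li yi yz; split; lia.
have out l : l <= i.+1 -> l != x ->
    (index l (a ++ u ++ b) < size a) || (size a + 2 < index l (a ++ u ++ b)).
  move=> li lx; rewrite index_cat3 //; case: ifP => la; first by rewrite index_mem la.
  rewrite inu !inE (negPf lx).
  have [-> ->] : (l == y) = false /\ (l == z) = false by clear -li yi yz; split; lia.
  by rewrite /=; clear; lia.
split=> [l|l l'].
  have [-> |lx] := eqVneq l x => li.
    move: (par x li); rewrite ix jx !oddD => <-; congr (_ (+) _).
    by clear -uxE vxE; case/orP: uxE => /eqP->; case/orP: vxE => /eqP->.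
  by rewrite same //; [exact: par|by case/andP: li].
move=> ll li; have := dec l l' ll li.
have [e|lx] := eqVneq l x; have [e'|lx'] := eqVneq l' x.
- by clear -e e' ll; lia.
- by rewrite (same l') // e jx ix; have := out l' li lx'; clear -uxE vxE; lia.
- rewrite (same l) // ?e' ?jx ?ix; last by clear -ll li; lia.
  by have := out l _ lx; clear -uxE vxE ll li; lia.
- rewrite !same //; clear -ll li; lia.
Qed.

Lemma step_sym u v : step u v -> step v u.
Proof. by case=> a b x y z {}u {}v xy yz ut vt; apply: (Step _ _ xy yz). Qed.

Lemma descending_eqv p i u v :
  eqv u v -> uniq u -> 0 \notin u -> descending p i u <-> descending p i v.
Proof.
elim=> {u v} [u v uv|//|u v uv IH|u v w uv IH1 _ IH2] uu u0.
- split; apply: descending_step => //; first exact: step_sym.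
    by rewrite -(perm_uniq (step_perm uv)).
  by rewrite -(perm_mem (step_perm uv)).
- rewrite IH // ?(perm_uniq (eqv_perm uv)) //.
  by rewrite (perm_mem (eqv_perm uv)).
- rewrite IH1 // IH2 // -?(perm_uniq (eqv_perm uv)) //.
  by rewrite -(perm_mem (eqv_perm uv)).
Qed.

(** In a canonical word on consecutive letters the least [j./2.+1] letters
    occupy every second place, from place [j] down. *)
Lemma index_canon k n j t :
  j < n -> t.*2 <= j -> index (k + t) (canon (iota k n) j) = j - t.*2.
Proof.
elim/ltn_ind: j k n t => -[|[|j]] IH k [|n] t //.
- by case: t => // _ _; rewrite addn0 /= eqxx.
- by case: n t => [|n] [|t] // _ _; rewrite addn0 /= eqxx; case: eqP => //; lia.
rewrite ltnS => jn tj; rewrite /iota -/iota canonSS.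
have sc : size (take j.+2 (canon (iota k.+1 n) j)) = j.+2.
  by rewrite size_takel // size_canon size_iota.
case: t tj => [|t] tj.
  rewrite addn0 index_cat ifN; first by rewrite sc /= eqxx addn0.
  apply/negP => /mem_take; rewrite (perm_mem (canon_perm _ _)) mem_iota ltnn //.
have it : index (k + t.+1) (canon (iota k.+1 n) j) = j - t.*2.
  by rewrite -addSnnS; apply: IH; lia.
have mt : k + t.+1 \in take j.+2 (canon (iota k.+1 n) j).
  rewrite in_take ?it; first lia.
  by rewrite (perm_mem (canon_perm _ _)) mem_iota; lia.
by move: it; rewrite -[X in index _ X](cat_take_drop j.+2) !index_cat mt; lia.
Qed.

Lemma descending_canon n j :
  j < n -> descending (odd j) j./2 (canon (iota 1 n) j).
Proof.
move=> jn; have idx l : 0 < l <= j./2.+1 ->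
    index l (canon (iota 1 n) j) = j - l.-1.*2.
  case: l => // l; rewrite ltnS /= => lj.
  by rewrite -[l.+1]add1n index_canon //; lia.
split=> [l lj|l l' ll lj].
  by rewrite idx // oddB ?odd_double ?addbF //; clear -lj; lia.
by rewrite !idx //; clear -ll lj; lia.
Qed.

Lemma not_descending_canon p n j :
  j < n -> ~ descending p j./2.+1 (canon (iota 1 n) j).
Proof.
move=> jn [par dec]; have j2 := odd_double_half j.
have := dec j./2.+1 j./2.+2; rewrite !ltnS !leqnn => /(_ isT isT).
have p1 := par j./2.+1 (leqnSn _); have p2 := par j./2.+2 (leqnn _).
move: p1; rewrite -p2.
have -> : index j./2.+1 (canon (iota 1 n) j) = odd j.
  by rewrite -add1n index_canon //; clear -j2; lia.
by case: (index _ _) => [|k]; case: (odd j).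
Qed.

Lemma descendingW p i k w : k <= i -> descending p i w -> descending p k w.
Proof.
move=> ki [par dec]; split=> [l /andP[l0 lk]|l l' ll lk].
  by apply: par; rewrite l0 (leq_trans lk).
by apply: dec => //; apply: leq_trans lk _.
Qed.

Lemma canon_inj n j k :
  j < n -> k < n -> eqv (canon (iota 1 n) j) (canon (iota 1 n) k) -> j = k.
Proof.
move=> jn kn; have ui i : uniq (canon (iota 1 n) i).
  by rewrite (perm_uniq (canon_perm _ _)) iota_uniq.
have ni i : 0 \notin canon (iota 1 n) i.
  by rewrite (perm_mem (canon_perm _ _)) mem_iota.
have le a b : a < n -> b < n -> eqv (canon (iota 1 n) a) (canon (iota 1 n) b) ->
    (odd a = odd b) /\ a./2 <= b./2.
  move=> an bn /(@descending_eqv (odd a) a./2)[//|//|+ _].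
  move=> /(_ (descending_canon an)) da; split.
    have [pa _] := da; have [pb _] := descending_canon bn.
    by rewrite -(pa 1) // -(pb 1).
  rewrite leqNgt; apply/negP => ba; have := descendingW ba da.
  exact: not_descending_canon.
move=> e; have [o1 h1] := le _ _ jn kn e; have [o2 h2] := le _ _ kn jn (eqv_sym e).
have := odd_double_half j; have := odd_double_half k; rewrite o1.
by clear -h1 h2; lia.
Qed.

(** * The number of avoiders *)

Lemma permutations_rcons (s : seq nat) :
  uniq s -> s != [::] ->
  perm_eq (permutations s)
    (flatten [seq [seq rcons u x | u <- permutations (rem x s)] | x <- s]).
Proof.
move=> us s0; apply: uniq_perm; first exact: permutations_uniq.
  apply: allpairs_uniq_dep => //.
    by move=> x _; apply: permutations_uniq.
  by move=> [x u] [y v] /= _ _ /rcons_inj[-> ->].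
move=> w; rewrite mem_permutations; apply/idP/flatten_mapP.
  case/lastP: w => [|u x] p.
    by rewrite perm_sym in p; rewrite (perm_nilP p) in s0.
  have xs : x \in s by rewrite -(perm_mem p) mem_rcons mem_head.
  exists x => //; apply/mapP; exists u => //; rewrite mem_permutations.
  rewrite -(perm_cons x) -(permPr (perm_to_rem xs)) -(permPr p).
  by rewrite perm_sym perm_rcons.
move=> [x xs /mapP[u]]; rewrite mem_permutations => pu ->.
by rewrite perm_rcons perm_sym (permPl (perm_to_rem xs)) perm_cons perm_sym.
Qed.

Lemma count_permutations_rcons (P : pred (seq nat)) s :
  uniq s -> s != [::] -> count P (permutations s) =
  \sum_(x <- s) count (fun u => P (rcons u x)) (permutations (rem x s)).
Proof.
move=> us s0; rewrite (seq.permP (permutations_rcons us s0)) count_flatten.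
rewrite -map_comp sumnE big_map; apply: eq_bigr => x _.
by rewrite /= count_map.
Qed.

Lemma avoids_rcons_min u x m :
  all (ltn m) u -> m < x -> avoids (rcons (rcons u m) x) = avoids (rcons u m).
Proof.
case/lastP: u => // u p; rewrite all_rcons => /andP[/= mp _] mx.
by rewrite avoids_rconsE andb_idr // /bad; clear -mx mp; lia.
Qed.

(** Otherwise the least letter and the next two letters form a bad triple. *)
Lemma last_min m t u x :
  sorted ltn (m :: t) -> perm_eq u (m :: t) -> m < x -> x \notin t ->
  avoids (rcons u x) -> exists u', u = rcons u' m.
Proof.
move=> ss pu mx xt; have us := sorted_uniq_nat ss.
have mu : m \in u by rewrite (perm_mem pu) mem_head.
case/splitPr: mu pu => p q pu.
case/lastP: q pu => [|q y] pu; first by exists p; rewrite cats1.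
rewrite -cat_rcons -cats1 -catA cat_rcons => av.
exfalso; apply/negP: av.
have pq : perm_eq (p ++ rcons q y) t.
  by rewrite -(perm_cons m) -(permPr pu) -[m :: rcons q y]cat1s perm_sym perm_catCA.
apply: nonavoid_min; rewrite ?cats1 ?size_rcons //.
- rewrite all_rcons /= mx /=; have := sorted_min ss.
  by rewrite -(perm_all _ pq) all_cat => /andP[].
- have ut : uniq (p ++ rcons q y) by rewrite (perm_uniq pq); case/andP: us.
  move: ut; rewrite cat_uniq => /and3P[_ _ uq].
  rewrite rcons_uniq uq andbT; apply: contra xt.
  by rewrite -(perm_mem pq) mem_cat => ->; rewrite orbT.
Qed.

(** The number of avoiders on the letters [m :: t] that end with [m]. *)
Definition end_min (m : nat) (t : seq nat) : nat :=
  count (fun u => avoids (rcons u m)) (permutations t).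

Lemma rem_tail (m x : nat) t :
  uniq (m :: t) -> x \in t -> rem x (m :: t) = m :: rem x t.
Proof.
by move=> /andP[mt _] xt /=; case: eqP => // e; rewrite e xt in mt.
Qed.

Lemma sorted_rem (x : nat) s : sorted ltn s -> sorted ltn (rem x s).
Proof. by apply: subseq_sorted (rem_subseq _ _); exact: ltn_trans. Qed.

(** An avoider ending with a letter other than the least ends with the least
    letter followed by that letter. *)
Lemma count_end_other m t x :
  sorted ltn (m :: t) -> m < x -> x \notin t ->
  count (fun u => avoids (rcons u x)) (permutations (m :: t)) = end_min m t.
Proof.
move=> ss mx xt; have us := sorted_uniq_nat ss.
rewrite count_permutations_rcons // big_cons /= eqxx.
rewrite big1_seq ?addn0.
  apply: eq_in_count => u; rewrite mem_permutations => pu.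
  by rewrite avoids_rcons_min // (perm_all _ pu) sorted_min.
move=> y /andP[_ yt]; rewrite -[if _ then _ else _]/(rem y (m :: t)).
apply/eqP; rewrite -leqn0 leqNgt -has_count.
apply/hasPn => u; rewrite mem_permutations => pu; apply/negP => av.
have ym : y != m by apply: contraTneq yt => ->; case/andP: us.
have [|u' /rcons_inj[_ e]] := last_min ss _ mx xt av; last by rewrite e eqxx in ym.
have ymt : y \in m :: t by rewrite inE yt orbT.
rewrite perm_rcons perm_sym (permPl (perm_to_rem ymt)).
by rewrite perm_cons perm_sym.
Qed.

(** The two summands count the avoiders with the least letter last and
    next to last. *)
Lemma count_avoids m t :
  sorted ltn (m :: t) ->
  count avoids (permutations (m :: t)) =
  end_min m t + \sum_(x <- t) end_min m (rem x t).
Proof.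
move=> ss; have us := sorted_uniq_nat ss.
rewrite count_permutations_rcons // big_cons; congr (_ + _).
  by rewrite /= eqxx.
apply: eq_big_seq => x xt; rewrite rem_tail //; apply: count_end_other.
- by rewrite -rem_tail //; apply: sorted_rem.
- exact: (allP (sorted_min ss)).
- by rewrite mem_rem_uniq ?inE ?eqxx //; case/andP: us.
Qed.

(** The letter [x] before the final [m] is not [m'], since a 321 would end the
    word; hence [m'] comes just before [x]. *)
Lemma end_min_rec m m' t :
  sorted ltn [:: m, m' & t] -> t != [::] ->
  end_min m (m' :: t) = \sum_(x <- t) end_min m' (rem x t).
Proof.
move=> ss t0; have us := sorted_uniq_nat ss; have ss' := path_sorted ss.
have us' := sorted_uniq_nat ss'.
have mm : m < m' by case/andP: ss.
rewrite [LHS]/end_min count_permutations_rcons // big_cons.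
have m't := sorted_min ss'.
rewrite [X in X + _](_ : _ = 0) ?add0n; last first.
  apply/eqP; rewrite -leqn0 leqNgt -has_count; apply/hasPn => u.
  rewrite mem_permutations /= eqxx => pu.
  case/lastP: u pu => [|u p] pu.
    by rewrite perm_sym in pu; rewrite (perm_nilP pu) in t0.
  rewrite avoids_rconsE negb_and negbK; apply/orP; right.
  have : m' < p by apply: (allP m't); rewrite -(perm_mem pu) mem_rcons mem_head.
  by rewrite /bad; clear -mm; lia.
apply: eq_big_seq => x xt; rewrite rem_tail // -(@count_end_other m' (rem x t) x).
- apply: eq_in_count => u; rewrite mem_permutations => pu.
  apply/idP/idP => [|av]; first by rewrite -[rcons (rcons _ _) _]cats1 => /avoids_catl.
  have [|||u' eu] := last_min _ pu _ _ av.
  + by rewrite -rem_tail //; apply: sorted_rem.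
  + exact: (allP m't).
  + by rewrite mem_rem_uniq ?inE ?eqxx //; case/andP: us'.
  rewrite eu avoids_rconsE -eu av /=.
  have := allP m't _ xt; rewrite /bad /=; clear -mm; lia.
- by rewrite -rem_tail //; apply: sorted_rem.
- exact: (allP m't).
- by rewrite mem_rem_uniq ?inE ?eqxx //; case/andP: us'.
Qed.

Lemma double_factorialSS m : double_factorial m.+2 = m.+2 * double_factorial m.
Proof.
rewrite /double_factorial; have -> : odd m.+2 = odd m by rewrite /= negbK.
rewrite big_mkcond big_nat_recr //= big_nat_recr //= negbK eqxx -big_mkcond.
by rewrite mulnC; case: (odd m); rewrite muln1.
Qed.

Lemma end_minE n m t :
  size t = n -> sorted ltn (m :: t) -> end_min m t = double_factorial n.-1.
Proof.
elim/ltn_ind: n m t => -[|[|n]] IH m t st ss.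
- by rewrite (size0nil st) /double_factorial big_geq.
- case: t st ss => [//|x [|//]] _ _.
  by rewrite /double_factorial big_geq.
case: t st ss => [//|m' t] [st] ss; rewrite end_min_rec //; last by case: t st {ss}.
have st' := path_sorted ss; have ut := sorted_uniq_nat st'.
transitivity (\sum_(x <- t) double_factorial n.-1).
  apply: eq_big_seq => x xt; apply: IH => //; first by rewrite size_rem // st.
  by rewrite -rem_tail //; apply: sorted_rem.
rewrite big_const_seq count_predT st iter_addn_0.
case: n st {IH} => [|n] _; last by rewrite double_factorialSS mulnC.
by rewrite /double_factorial [RHS]big_ltn_cond //= !big_geq.
Qed.

Lemma count_avoidsE n s :
  size s = n.+1 -> sorted ltn s -> 1 < n -> 
  count avoids (permutations s) = double_factorial n + double_factorial n.-1.
Proof.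
case: s => [//|m t] [st] ss n1; rewrite count_avoids // (end_minE st) // addnC.
have ut := sorted_uniq_nat ss; congr (_ + _).
transitivity (\sum_(x <- t) double_factorial n.-2).
  apply: eq_big_seq => x xt; apply: end_minE => //; first by rewrite size_rem // st.
  by rewrite -rem_tail //; apply: sorted_rem.
rewrite big_const_seq count_predT st iter_addn_0.
by case: n n1 {st} => [|[|n]] // _; rewrite double_factorialSS mulnC.
Qed.

(** * From words to permutations *)

Lemma nth_one_line n (s : 'S_n) (i : 'I_n) : nth 0 (one_line s) i = (s i).+1.
Proof. by rewrite (nth_map i) ?size_enum_ord // nth_ord_enum. Qed.

Lemma one_line_perm n (s : 'S_n) : perm_eq (one_line s) (iota 1 n).
Proof.
have us : uniq (one_line s).
  rewrite map_inj_uniq ?enum_uniq // => i j /succn_inj/val_inj.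
  exact: perm_inj.
apply: uniq_perm; rewrite ?iota_uniq //.
have sub : {subset one_line s <= iota 1 n}.
  by move=> _ /mapP[i _ ->]; rewrite mem_iota /= add1n ltnS ltn_ord.
by have [] := uniq_min_size us sub; rewrite // size_iota size_one_line.
Qed.

Lemma one_line_surj n w : perm_eq w (iota 1 n) -> exists s : 'S_n, one_line s = w.
Proof.
move=> pw; have sw : size w = n by rewrite (perm_size pw) size_iota.
have wi (i : 'I_n) : 0 < nth 0 w i <= n.
  have : nth 0 w i \in iota 1 n by rewrite -(perm_mem pw) mem_nth ?sw.
  by rewrite mem_iota add1n ltnS.
have lt (i : 'I_n) : (nth 0 w i).-1 < n by have := wi i; clear; lia.
have finj : injective (fun i : 'I_n => Ordinal (lt i)).
  move=> i j [] e; apply/val_inj/eqP.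
  have uw : uniq w by rewrite (perm_uniq pw) iota_uniq.
  have li : i < size w by rewrite sw.
  have lj : j < size w by rewrite sw.
  rewrite -(nth_uniq 0 li lj uw); apply/eqP.
  case/andP: (wi i) (wi j) => i0 _ /andP[j0 _].
  by rewrite -(prednK i0) -(prednK j0); congr _.+1.
exists (perm finj); apply: (@eq_from_nth _ 0); first by rewrite size_one_line.
move=> i; rewrite size_one_line => i_n.
rewrite (nth_one_line (perm finj) (Ordinal i_n)) permE /= prednK //.
by have /andP[] := wi (Ordinal i_n).
Qed.

Lemma order_permE (a b c p q r : nat) (sigma : 'S_3) :
  one_line sigma = [:: p; q; r] ->
  is_order_perm [:: a; b; c] sigma =
  [&& (p < q) == (a < b), (q < p) == (b < a), (p < r) == (a < c),
      (r < p) == (c < a), (q < r) == (b < c) & (r < q) == (c < b)].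
Proof.
move=> e; rewrite /is_order_perm eqxx.
have e0 : (sigma (@Ordinal 3 0 isT)).+1 = p by rewrite -nth_one_line e.
have e1 : (sigma (@Ordinal 3 1 isT)).+1 = q by rewrite -nth_one_line e.
have e2 : (sigma (@Ordinal 3 2 isT)).+1 = r by rewrite -nth_one_line e.
rewrite -e0 -e1 -e2 !ltnS; apply/forallP/and5P.
  move=> h; have h' i j := forallP (h i) j.
  split; last (apply/andP; split); exact: (h' (Ordinal _) (Ordinal _)).
move=> [h1 h2 h3 h4 /andP[h5 h6]] [[|[|[|//]]] i3]; apply/forallP => -[[|[|[|//]]] j3];
  rewrite ?(bool_irrelevance i3 isT) ?(bool_irrelevance j3 isT) //= ?ltnn //.
Qed.

Lemma triples_sort x y z x' y' z' u v :
  x < y -> y < z -> x' < y' -> y' < z' -> u \in triples x y z ->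
  v \in triples x' y' z' -> perm_eq u v -> v \in triples x y z.
Proof.
move=> xy yz xy' yz' /triples_perm pu vt puv.
suff [-> -> ->] : [:: x; y; z] = [:: x'; y'; z'] by [].
apply: (irr_sorted_eq ltn_trans ltnn); rewrite /= ?xy ?yz ?xy' ?yz' //.
apply: perm_mem; rewrite -(permPl pu) (permPl puv).
exact: triples_perm vt.
Qed.

(** The part of the replacement partition with more than one element. *)
Definition pattern3 : {set 'S_3} :=
  [set s : 'S_3 | one_line s \in [:: [:: 1; 2; 3]; [:: 1; 3; 2]; [:: 3; 2; 1]]].

(** The word has length three and its order permutation is 123, 132 or 321. *)
Definition bad_word (u : seq nat) : bool :=
  if u is [:: x; y; z] then bad x y z else false.

Lemma pattern3P u :
  reflect (exists2 s, s \in pattern3 & is_order_perm u s) (bad_word u).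
Proof.
apply: (iffP idP).
  case: u => [//|a [//|b [//|c [|//]]]] h.
  have [w wl hw] : exists2 w, w \in [:: [:: 1; 2; 3]; [:: 1; 3; 2]; [:: 3; 2; 1]] &
    forall s : 'S_3, one_line s = w -> is_order_perm [:: a; b; c] s.
    case/or3P: h => h;
      [exists [:: 1; 2; 3]|exists [:: 1; 3; 2]|exists [:: 3; 2; 1]] => // s e;
      rewrite (order_permE _ _ _ e); clear -h; lia.
  have [s es] : exists s : 'S_3, one_line s = w.
    apply: one_line_surj; move: wl; rewrite !inE => /or3P[] /eqP-> //.
  by exists s; [rewrite inE es|exact: hw].
move=> [s]; rewrite inE => es us.
have [/eqP su _] := andP us; case: u su us => [//|a [//|b [//|c [|//]]]] _.
by move: es; rewrite !inE => /or3P[] /eqP e; rewrite (order_permE _ _ _ e) /bad_word /bad;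
  clear; lia.
Qed.

Lemma bad_triples a b c :
  bad a b c -> exists x y z, [/\ x < y, y < z & [:: a; b; c] \in triples x y z].
Proof.
case/or3P=> /andP[h1 h2]; [exists a, b, c|exists a, c, b|exists c, b, a];
  by split=> //; rewrite !inE eqxx ?orbT.
Qed.

Lemma triples_bad x y z u : x < y -> y < z -> u \in triples x y z ->
  exists a b c, u = [:: a; b; c] /\ bad a b c.
Proof.
move=> xy yz; rewrite !inE => /or3P[] /eqP->;
  [exists x, y, z|exists x, z, y|exists z, y, x];
  by rewrite /bad ?xy ?yz ?orbT.
Qed.

Lemma same_order u v (s : 'S_3) :
  uniq u -> perm_eq u v -> is_order_perm u s -> is_order_perm v s -> u = v.
Proof.
move=> uu puv us vs; have [/eqP su _] := andP us; have [/eqP sv _] := andP vs.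
case: u uu puv us su => [//|a [//|b [//|c [|//]]]] uu puv us _.
case: v puv vs sv => [//|d [//|e [//|f [|//]]]] puv vs _.
have [p [q [r es]]] : exists p q r, one_line s = [:: p; q; r].
  have := size_one_line s; case: (one_line s) => [//|p [//|q [//|r [|//]]]] _.
  by exists p, q, r.
move: us vs; rewrite !(order_permE _ _ _ es).
have uv : uniq [:: d; e; f] by rewrite -(perm_uniq puv).
have := perm_mem puv d; have := perm_mem puv e; have := perm_mem puv f.
move: uu uv; rewrite /= !inE !eqxx ?orbT; clear => *.
have [-> [-> ->]] : a = d /\ b = e /\ c = f by lia.
by [].
Qed.

Lemma same_partP u v :
  uniq u -> perm_eq u v -> same_part K_123_132_321 u v ->
  u = v \/ exists x y z, [/\ x < y, y < z, u \in triples x y z & v \in triples x y z].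
Proof.
move=> uu puv /existsP[P /andP[PK /existsP[s /andP[sP /existsP[t]]]]].
case/and3P=> tP us vt; case/setUP: PK => [/set1P eP|/imsetP[s0 _ eP]].
  right; move: sP tP; rewrite {P}eP -/pattern3 => sP tP.
  have hu : bad_word u.
    by apply/pattern3P; exists s.
  have hv : bad_word v.
    by apply/pattern3P; exists t.
  case: u hu {uu us} puv => [//|a [//|b [//|c [|//]]]] /bad_triples.
  case=> [x [y [z [xy yz ut]]]] puv.
  case: v hv {vt} puv => [//|d [//|e [//|f [|//]]]] /bad_triples.
  case=> [x' [y' [z' [xy' yz' vt]]]] puv.
  by exists x, y, z; split=> //; apply: (triples_sort xy yz xy' yz' ut vt puv).
left; move: sP tP us vt; rewrite eP => /set1P-> /set1P->.
exact: same_order.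
Qed.

Lemma K_step_eqv n (phi psi : 'S_n) :
  K_step K_123_132_321 phi psi -> eqv (one_line phi) (one_line psi).
Proof.
move=> /K_stepP[a [u [v [b [ephi epsi su sv uv]]]]].
have p : perm_eq (a ++ u ++ b) (a ++ v ++ b).
  by rewrite -ephi -epsi (permPl (one_line_perm _)) perm_sym one_line_perm.
have uu : uniq u.
  have : uniq (a ++ u ++ b) by rewrite -ephi (perm_uniq (one_line_perm _)) iota_uniq.
  by rewrite cat_uniq => /and3P[_ _]; rewrite cat_uniq => /andP[].
rewrite ephi epsi; move: p; rewrite perm_cat2l perm_cat2r => puv.
have [->|[x [y [z [xy yz ut vt]]]]] := same_partP uu puv uv.
  exact: eqv_refl.
by apply: rst_step; apply: Step ut vt.
Qed.

Lemma step_K_step n (phi psi : 'S_n) :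
  step (one_line phi) (one_line psi) -> K_step K_123_132_321 phi psi.
Proof.
move=> st; apply/K_stepP.
case: st (erefl (one_line phi)) (erefl (one_line psi)).
move=> a b x y z u v xy yz ut vt ephi epsi.
have [su sv] : size u = 3 /\ size v = 3.
  by rewrite (perm_size (triples_perm ut)) (perm_size (triples_perm vt)).
exists a, u, v, b; split=> //.
apply/existsP; exists pattern3; rewrite !inE eqxx /=.
have [s sp us] : exists2 s, s \in pattern3 & is_order_perm u s.
  by apply/pattern3P; have [? [? [? [-> ]]]] := triples_bad xy yz ut.
have [t tp vs] : exists2 s, s \in pattern3 & is_order_perm v s.
  by apply/pattern3P; have [? [? [? [-> ]]]] := triples_bad xy yz vt.
by apply/existsP; exists s; rewrite sp; apply/existsP; exists t; rewrite tp us.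
Qed.

Lemma K_equiv_eqv n (phi psi : 'S_n) :
  K_equiv K_123_132_321 phi psi <-> eqv (one_line phi) (one_line psi).
Proof.
split=> [/K_equivP|].
  elim=> {phi psi} [s t|s|s t _|s t r _ st _].
  - exact: K_step_eqv.
  - exact: eqv_refl.
  - exact: eqv_sym.
  - exact: eqv_trans.
suff main w w' : eqv w w' -> forall phi psi : 'S_n,
    one_line phi = w -> one_line psi = w' -> K_equiv K_123_132_321 phi psi.
  by move=> e; apply: main e _ _ _ _.
elim=> {w w'} [w w' st|w|w w' _ IH|w v w' wv IH1 _ IH2] {}phi {}psi ew ew'.
- by apply: connect1; apply: step_K_step; rewrite ew ew'.
- by rewrite (@one_line_inj _ phi psi) ?ew //; apply: connect0.
- by rewrite /K_equiv (sym_connect_sym (@K_step_sym _ _ _)); apply: IH.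
have [|s es] := @one_line_surj n v.
  by rewrite -(permPl (eqv_perm wv)) -ew one_line_perm.
exact: connect_trans (IH1 _ _ ew es) (IH2 _ _ es ew').
Qed.

Lemma step_avoids u v : step u v -> ~~ avoids u.
Proof.
case=> {u v} a b x y z u v xy yz ut _.
have [p [q [r [-> h]]]] := triples_bad xy yz ut.
by apply: contraL h; apply: avoids_bad.
Qed.

Lemma eqv_avoids u v : eqv u v -> avoids u || avoids v -> u = v.
Proof.
elim=> {u v} [u v uv|//|u v _ IH|u v w _ IH1 _ IH2].
- by rewrite (negPf (step_avoids uv)) (negPf (step_avoids (step_sym uv))).
- by rewrite orbC => /IH.
case/orP=> h.
  have e : u = v by apply: IH1; rewrite h.
  by rewrite e; apply: IH2; rewrite -e h.
have e : v = w by apply: IH2; rewrite h orbT.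
by rewrite -e; apply: IH1; rewrite e h orbT.
Qed.

Lemma canon_nonavoid n j : j + 2 < n -> ~~ avoids (canon (iota 1 n) j).
Proof.
case: n => [|n] jn; first by rewrite addn2 in jn.
have ss : sorted ltn (iota 1 n.+1) by exact: iota_ltn_sorted.
have [c [e [ec sc]]] : exists c e, canon (iota 1 n.+1) j = c ++ 1 :: e /\ size c = j.
  by apply: canon_split; rewrite /= size_iota; clear -jn; lia.
have p := canon_perm (iota 1 n.+1) j.
have := perm_size p; rewrite ec size_cat size_iota /= => se.
have := perm_uniq p; rewrite ec iota_uniq cat_uniq cons_uniq => /and3P[_ _ /andP[_ ue]].
apply: nonavoid_min => //; last by clear -se sc jn; lia.
have := sorted_min ss; rewrite -(perm_all _ (s1 := c ++ e)).
  by rewrite all_cat => /andP[].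
by rewrite -(perm_cons 1) -(permPr p) ec -[1 :: e]cat1s perm_sym perm_catCA.
Qed.

Lemma card_one_line n (P : pred (seq nat)) :
  #|[set s : 'S_n | P (one_line s)]| = count P (permutations (iota 1 n)).
Proof.
rewrite cardsE cardE {1}/enum_mem size_filter -enumT.
have <- : count P (map (@one_line n) (enum 'S_n)) = count P (permutations (iota 1 n)).
  apply/seq.permP/uniq_perm.
    by rewrite map_inj_uniq ?enum_uniq //; apply: one_line_inj.
    exact: permutations_uniq.
  move=> w; rewrite mem_permutations; apply/mapP/idP => [[s _ ->]|].
    exact: one_line_perm.
  by move=> /one_line_surj[s <-]; exists s; rewrite // mem_enum.
by rewrite count_map.
Qed.

Theorem proposition2p8 (n : nat) (hn : 5 <= n) :
  #|K_classes n K_123_132_321|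
  = double_factorial (n - 1) + double_factorial (n - 2) + (n - 2).
Proof.
(* Avoiders and canonical words together represent every class once. *)
pose L := [seq canon (iota 1 n) j | j <- iota 0 (n - 2)].
pose R w := avoids w || (w \in L).
have LP w : w \in L -> exists2 j, j + 2 < n & w = canon (iota 1 n) j.
  by case/mapP=> j; rewrite mem_iota => jn ->; exists j => //; clear -jn; lia.
pose cls (s : 'S_n) := [set t in [set: 'S_n] | K_equiv K_123_132_321 s t].
have clsE s t : cls s = cls t <-> eqv (one_line s) (one_line t).
  rewrite -K_equiv_eqv; split=> [/setP/(_ t)|st].
    by rewrite !inE /K_equiv connect0.
  apply/setP => r; rewrite !inE; apply: same_connect => //.
  exact/sym_connect_sym/K_step_sym.
have -> : K_classes n K_123_132_321 = cls @: [set s | R (one_line s)].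
  apply/eqP; rewrite eqEsubset; apply/andP; split;
    apply/subsetP => _ /imsetP[s _ ->]; last first.
    exact: imset_f.
  have [as_|ns] := boolP (avoids (one_line s)).
    by apply: imset_f; rewrite inE /R as_.
  have [|j jn ej] := reducible_ge5 hn (iota_ltn_sorted 1 n) (size_iota 1 n) _ ns.
    exact: one_line_perm.
  have [t et] := one_line_surj (canon_perm (iota 1 n) j).
  rewrite -[imset _ _]/(cls @: _).
  have -> : [set y in [set: 'S_n] | K_equiv K_123_132_321 s y] = cls t.
    by apply/clsE; rewrite et.
  apply: imset_f; rewrite inE /R et; apply/orP; right; apply: map_f.
  by rewrite mem_iota; move: jn; rewrite size_iota; clear; lia.
rewrite card_in_imset; last first.
  move=> s t; rewrite !inE => Rs Rt /clsE e; apply: one_line_inj.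
  have [a|na] := boolP (avoids (one_line s) || avoids (one_line t)).
    exact: eqv_avoids e a.
  move: Rs Rt na e; rewrite /R negb_or.
  case: avoids => //= sL; case: avoids => //= tL _.
  have [j jn ->] := LP _ sL; have [k kn ->] := LP _ tL => e.
  by rewrite (canon_inj (leq_ltn_trans (leq_addr 2 j) jn)
                     (leq_ltn_trans (leq_addr 2 k) kn) e).
rewrite (card_one_line n R).
have disj : count (predI avoids (mem L)) (permutations (iota 1 n)) = 0.
  apply/eqP; rewrite -leqn0 leqNgt -has_count; apply/hasPn => w _ /=.
  apply/negP => /andP[aw /LP[j jn ew]].
  by move: aw; rewrite ew (negPf (canon_nonavoid jn)).
rewrite (_ : count R _ = count (predU avoids (mem L)) (permutations (iota 1 n))) //.
rewrite -[LHS]addn0 -[X in _ + X = _]disj count_predUI; congr (_ + _).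
  rewrite (@count_avoidsE (n - 1)) ?size_iota ?iota_ltn_sorted //; last by clear -hn; lia.
    by rewrite subn1 (_ : n.-2 = n - 2) // -subn2.
  by clear -hn; lia.
rewrite -size_filter -[RHS](size_iota 0) -(size_map (canon (iota 1 n))) -/L.
apply/perm_size/uniq_perm.
- by apply: filter_uniq; apply: permutations_uniq.
- rewrite map_inj_in_uniq ?iota_uniq // => j k; rewrite !mem_iota => jn kn ejk.
  apply: (@canon_inj n); [clear -jn; lia|clear -kn; lia|rewrite ejk; exact: eqv_refl].
move=> w; rewrite mem_filter mem_permutations andb_idr //= => /LP[j _ ->].
exact: canon_perm.
Qed.
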